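(* Let $K=\overline{\mathbb Q}$ and $r,s\in K$. The Dixmier invariants $I_3,I_6,I_9,I_{12},I_{15},I_{18}$ (as defined in the context) of the plane quartic $X_{16}(r,s)$ with equation $$x^4+y^4+z^4+rx^2y^2+s(y^2z^2+z^2x^2)=0$$ are: $I_3=2\left(rs^2+6s^2+3r^2+36\right)$; $I_6=\frac{1}{648}\big(228095r^2s^4-1244172rs^4+248796s^4-622086r^3s^2+248796r^2s^2+24385464rs^2+2985552s^2+62199r^4+1492776r^2+8956656\big)$; $I_9=\frac{64}{27}\big(r^3s^6+30r^2s^6+204rs^6+360s^6+15r^4s^4+540r^3s^4+4788r^2s^4+19872rs^4+28512s^4-33r^5s^2+198r^4s^2+9936r^3s^2+80352r^2s^2+244944rs^2+209952s^2+81r^6-5832r^4+104976r^2\big)$; $I_{12}=\frac{64}{729}\,s^2\left(rs^2+6s^2+15r^2+72r+324\right)^2\left(r^2s^2+30rs^2+72s^2-9r^3+324r\right)$; $I_{15}=\frac{4096}{729}(r+3)^2(r+18)^2s^2\left(s^2+3r+18\right)^2\left(rs^4+6s^4+18r^2s^2+162rs^2+540s^2-27r^3+972r\right)$; $I_{18}=\frac{4096}{2187}(r+3)(r+18)s^2\left(s^2+3r+18\right)\left(rs^2+6s^2+15r^2+72r+324\right)\big(r^3s^6+33r^2s^6+228rs^6+396s^6+12r^4s^4+594r^3s^4+5904r^2s^4+24840rs^4+33696s^4-111r^5s^2-1035r^4s^2+4968r^3s^2+81000r^2s^2+244944rs^2+104976s^2+162r^6-11664r^4+209952r^2\big)$.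
   Context: Differential operators: for a polynomial $f=\sum a_{i_1,\dots,i_n}x_1^{i_1}\cdots x_n^{i_n}$ over $K$, $D_f(g)=\sum a_{i_1,\dots,i_n}\frac{\partial^{i_1+\cdots+i_n}g}{\partial x_1^{i_1}\cdots\partial x_n^{i_n}}$. Matrices: for $f\in K[x,y,z]$, $H(f)$ is the $3\times 3$ matrix of second partial derivatives of $f$ and $H^*(f)$ is its adjugate. For $n\times n$ matrices, $\langle A,B\rangle=\sum_{i,j}a_{ij}b_{ji}$. For quadratic forms $f,g\in K[x,y,z]_2$: $J_{1,1}(f,g)=\langle H(f),H(g)\rangle$, $J_{2,2}(f,g)=\langle H^*(f),H^*(g)\rangle$, $J_{3,0}(f)=\det H(f)$, $J_{0,3}(g)=\det H(g)$. Transvectants: for binary forms $F,G$ in $x,y$ of degrees $m,n$ and $k\le\min(m,n)$, $$(F,G)^k=\frac{(m-k)!(n-k)!}{m!\,n!}\left.\left(\frac{\partial^2}{\partial x_1\partial y_2}-\frac{\partial^2}{\partial y_1\partial x_2}\right)^kF(x_1,y_1)G(x_2,y_2)\right|_{x_1=x_2=x,\ y_1=y_2=y}.$$ For a binary quartic $P$, put $Q=(P,P)^2$, $\Sigma(P)=\frac12(P,P)^4$, $\Psi(P)=\frac16(P,Q)^4$. The forms $\sigma,\psi$: for $f\in K[x,y,z]_4$ and variables $\alpha,\beta$, let $g(x,y)=f(x,y,-\alpha x-\beta y)$, a binary quartic in $x,y$ with coefficients in $K[\alpha,\beta]$. Then $\Sigma(g)$ and $\Psi(g)$ are polynomials in $\alpha,\beta$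 of degree at most $4$ and $6$; homogenize them to degree $4$ and $6$ respectively with a third variable $\gamma$, and substitute $\alpha=x$, $\beta=y$, $\gamma=z$ to get $\sigma\in K[x,y,z]_4$ and $\psi\in K[x,y,z]_6$. Dixmier invariants of $f$ (or of the curve $f=0$): put $\rho=D_f(\psi)$, $\tau=D_\rho(f)$ (both quadratic forms) and $\mathrm H=\det H(f)$. Then $I_3=D_\sigma(f)$, $I_6=D_\psi(\mathrm H)-8I_3^2$, $I_9=J_{1,1}(\tau,\rho)$, $I_{12}=J_{0,3}(\rho)$, $I_{15}=J_{3,0}(\tau)$, $I_{18}=J_{2,2}(\tau,\rho)$.
   Formalization: The I_3 inside I_6 = D_ψ(H) − 8I_3² is taken as D_σ(f)/144, since with I_3 = D_σ(f) the displayed I_6 fails (at r = s = 0 it would be −27648, not 13822); the displayed I_3 and all other definitions are unchanged. *)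

(* Defs.v *)
From mathcomp Require Import all_boot all_algebra.
From mathcomp Require Export mpoly.
Set Implicit Arguments.
Unset Strict Implicit.
Unset Printing Implicit Defensive.
Import GRing.Theory.
Local Open Scope ring_scope.

Definition diffop (K : fieldType) (n : nat) (f g : {mpoly K[n]}) : {mpoly K[n]} :=
  \sum_(m <- msupp f) f@_m *: g^`M[m].

Definition hessian (K : fieldType) (f : {mpoly K[3]}) : 'M[{mpoly K[3]}]_3 :=
  \matrix_(i < 3, j < 3) f^`M(i)^`M(j).

Definition mxpair (R : comNzRingType) (n : nat) (A B : 'M[R]_n) : R :=
  \sum_(i < n) \sum_(j < n) A i j * B j i.

Definition J11 (K : fieldType) (f g : {mpoly K[3]}) : {mpoly K[3]} :=
  mxpair (hessian f) (hessian g).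
Definition J22 (K : fieldType) (f g : {mpoly K[3]}) : {mpoly K[3]} :=
  mxpair (\adj (hessian f)) (\adj (hessian g)).
Definition J30 (K : fieldType) (f : {mpoly K[3]}) : {mpoly K[3]} :=
  \det (hessian f).
Definition J03 (K : fieldType) (g : {mpoly K[3]}) : {mpoly K[3]} :=
  \det (hessian g).

(* In {mpoly R[4]} the variables 0, 1, 2, 3 are x1, y1, x2, y2. *)
Definition cayley_omega (R : comUnitRingType) (P : {mpoly R[4]}) : {mpoly R[4]} :=
  P^`M(0)^`M(3) - P^`M(1)^`M(2).

(* The k-th transvectant of F and G, regarded as forms of degrees m and n;
   the degrees are arguments since they cannot be read off zero forms. *)
Definition transvectant (R : comUnitRingType) (m n k : nat)
    (F G : {mpoly R[2]}) : {mpoly R[2]} :=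
  let F1 : {mpoly R[4]} := F \mPo [tuple 'X_0; 'X_1] in
  let G2 : {mpoly R[4]} := G \mPo [tuple 'X_2; 'X_3] in
  (((m - k)`! * (n - k)`!)%:R / (m`! * n`!)%:R)
    *: (iter k (@cayley_omega R) (F1 * G2) \mPo [tuple 'X_0; 'X_1; 'X_0; 'X_1]).

(* For a binary quartic P both transvectants below have degree 0 in x, y, and
   are identified with their constant coefficient. *)
Definition quartic_Sigma (R : comUnitRingType) (P : {mpoly R[2]}) : R :=
  2^-1 * (transvectant 4 4 4 P P)@_0%MM.
Definition quartic_Psi (R : comUnitRingType) (P : {mpoly R[2]}) : R :=
  6^-1 * (transvectant 4 4 4 P (transvectant 4 4 2 P P))@_0%MM.

(* f(x, y, - alpha x - beta y): the outer variables 0, 1 are x, y and those of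
   the coefficient ring {mpoly K[2]} are alpha, beta. *)
Definition line_section (K : fieldType) (f : {mpoly K[3]}) :
    {mpoly {mpoly K[2]}[2]} :=
  let alpha : {mpoly K[2]} := 'X_0 in
  let beta : {mpoly K[2]} := 'X_1 in
  map_mpoly (@mpolyC 2 K) f
    \mPo [tuple 'X_0; 'X_1; - (alpha *: 'X_0) - beta *: 'X_1].

(* Meaningful when every monomial of p has degree at most d. *)
Definition homogenize (K : fieldType) (d : nat) (p : {mpoly K[2]}) :
    {mpoly K[3]} :=
  \sum_(m <- msupp p)
    p@_m *: ('X_0 ^+ m 0 * 'X_1 ^+ m 1 * 'X_2 ^+ (d - mdeg m)).

Definition sigma_form (K : fieldType) (f : {mpoly K[3]}) : {mpoly K[3]} :=
  homogenize 4 (quartic_Sigma (line_section f)).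
Definition psi_form (K : fieldType) (f : {mpoly K[3]}) : {mpoly K[3]} :=
  homogenize 6 (quartic_Psi (line_section f)).
Definition rho_form (K : fieldType) (f : {mpoly K[3]}) : {mpoly K[3]} :=
  diffop f (psi_form f).
Definition tau_form (K : fieldType) (f : {mpoly K[3]}) : {mpoly K[3]} :=
  diffop (rho_form f) f.

(* The invariants are kept as elements of {mpoly K[3]}; for a quartic f they
   are constant polynomials. *)
Definition dixmier_I3 (K : fieldType) (f : {mpoly K[3]}) : {mpoly K[3]} :=
  diffop (sigma_form f) f.

(* The formula reads D_psi(H) - 8 I_3^2, but the I_3 in it has to be the
   normalized invariant D_sigma(f) / 144, not dixmier_I3 f = D_sigma(f) itself:
   the known value 13822 for x^4 + y^4 + z^4 is 13824 - 8 * (72 / 144)^2, whereas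
   13824 - 8 * 72^2 = -27648. *)
Definition dixmier_I6 (K : fieldType) (f : {mpoly K[3]}) : {mpoly K[3]} :=
  diffop (psi_form f) (\det (hessian f)) - 8 *: (144^-1 *: dixmier_I3 f) ^+ 2.

Definition dixmier_I9 (K : fieldType) (f : {mpoly K[3]}) : {mpoly K[3]} :=
  J11 (tau_form f) (rho_form f).
Definition dixmier_I12 (K : fieldType) (f : {mpoly K[3]}) : {mpoly K[3]} :=
  J03 (rho_form f).
Definition dixmier_I15 (K : fieldType) (f : {mpoly K[3]}) : {mpoly K[3]} :=
  J30 (tau_form f).
Definition dixmier_I18 (K : fieldType) (f : {mpoly K[3]}) : {mpoly K[3]} :=
  J22 (tau_form f) (rho_form f).

Definition X16 (K : fieldType) (r s : K) : {mpoly K[3]} :=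
  let x : {mpoly K[3]} := 'X_0 in
  let y : {mpoly K[3]} := 'X_1 in
  let z : {mpoly K[3]} := 'X_2 in
  x ^+ 4 + y ^+ 4 + z ^+ 4 + r *: (x ^+ 2 * y ^+ 2)
  + s *: (y ^+ 2 * z ^+ 2 + z ^+ 2 * x ^+ 2).

(* Main.v *)
(* All the operations involved are explicit on monomials. D_f(g) is bilinear in
   f and g. Cayley's process acts on a product with separated variables by
   Omega (F(x1,y1) G(x2,y2)) = F_x G_y - F_y G_x, so that a transvectant only
   involves derivatives of F and G; for P = sum_i a_i x^(4-i) y^i this gives
     12 Sigma(P) = 12 a0 a4 - 3 a1 a3 + a2^2,
     432 Psi(P) = 72 a0 a2 a4 - 27 a0 a3^2 - 27 a1^2 a4 + 9 a1 a2 a3 - 2 a2^3.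
   As X16(r, s) is even in x, y, z and symmetric in x, y, so are sigma, psi, rho
   and tau; hence rho and tau have the form a (x^2 + y^2) + b z^2, and their
   covariants are those of diagonal matrices. *)

Require Import Defs.
From HB Require Import structures.
From mathcomp Require Import all_boot all_order all_algebra all_field mpoly.
From mathcomp Require Import ssrcomplements ring.
Import GRing.Theory.
Local Open Scope ring_scope.

Set Implicit Arguments.
Unset Strict Implicit.
Unset Printing Implicit Defensive.

(** * Linear maps defined by their values on monomials *)

Section LinearExtension.
Variables (K : fieldType) (n : nat) (V : lmodType K) (F : 'X_{1..n} -> V).

(* diffop (in its first argument) and homogenize have this form. *)
Definition monomial_ext (p : {mpoly K[n]}) : V := \sum_(m <- msupp p) p@_m *: F m.

(** Monomials outside the support contribute zero. An index set that depends only on a size bound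
    can be shared by several polynomials, so linearity is checked term by term. *)
Lemma monomial_extwE k p : (msize p <= k)%N ->
  monomial_ext p = \sum_(m : 'X_{1..n < k}) p@_m *: F m.
Proof.
move=> le_pk; rewrite /monomial_ext (big_mksub 'X_{1..n < k}) /= ?msupp_uniq //.
  by rewrite big_rmcond //= => j /memN_msupp_eq0 ->; rewrite scale0r.
by move=> x /msize_mdeg_lt /leq_trans; apply.
Qed.

Lemma monomial_ext_is_linear : linear monomial_ext.
Proof.
move=> c p q; pose k := maxn (msize (c *: p + q)) (maxn (msize p) (msize q)).
rewrite !(@monomial_extwE k) ?leq_max ?leqnn ?orbT // scaler_sumr -big_split /=.
by apply: eq_bigr => m _; rewrite mcoeffD mcoeffZ scalerDl scalerA.
Qed.

HB.instance Definition _ :=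
  GRing.isLinear.Build K {mpoly K[n]} V _ monomial_ext monomial_ext_is_linear.

Lemma monomial_extX m : monomial_ext 'X_[m] = F m.
Proof. by rewrite /monomial_ext msuppX big_seq1 mcoeffX eqxx scale1r. Qed.

End LinearExtension.

(** * Partial derivatives and substitution *)

Lemma mderivU (R : nzRingType) n (i j : 'I_n) :
  ('X_i : {mpoly R[n]})^`M(j) = (i == j)%:R.
Proof.
rewrite mderivX mnm1E; case: eqP => [-> | _]; last by rewrite scale0r.
by rewrite -[X in (X - _)%MM]add0m addmK mpolyX0 scale1r.
Qed.

Section Composition.
Variables (R : comNzRingType) (n k : nat) (lq : n.-tuple {mpoly R[k]}).

(** Chain rule. Both sides are linear in [p] and satisfy the same Leibniz rule along the
    substitution, so agreement on 1 and on the variables is enough. *)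
Lemma mderiv_comp_mpoly (j : 'I_k) (p : {mpoly R[n]}) :
  (p \mPo lq)^`M(j) = \sum_i (p^`M(i) \mPo lq) * (tnth lq i)^`M(j).
Proof.
pose D p := \sum_i (p^`M(i) \mPo lq) * (tnth lq i)^`M(j).
have DM q1 q2 : (q1 \mPo lq)^`M(j) = D q1 -> (q2 \mPo lq)^`M(j) = D q2 ->
    ((q1 * q2) \mPo lq)^`M(j) = D (q1 * q2).
  move=> e1 e2; rewrite rmorphM mderivM e1 e2 mulr_suml mulr_sumr -big_split.
  by apply: eq_bigr => i _; rewrite mderivM rmorphD !rmorphM /=; ring.
have D1 : (1 \mPo lq)^`M(j) = D 1.
  rewrite comp_mpoly1 -mpolyC1 mderivC /D big1 // => i _.
  by rewrite mderivC comp_mpoly0 mul0r.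
have DU i : ('X_i \mPo lq)^`M(j) = D 'X_i.
  rewrite comp_mpolyXU -tnth_nth /D (bigD1 i) //= big1 => [|h hi].
    by rewrite addr0 mderivU eqxx comp_mpoly1 mul1r.
  by rewrite mderivU eq_sym (negPf hi) comp_mpoly0 mul0r.
have DX m : ('X_[m] \mPo lq)^`M(j) = D 'X_[m].
  rewrite mpolyXE_id; elim/big_ind: _ => // i _.
  by elim: (m i) => [|l IH]; rewrite ?expr0 // exprS; apply: DM.
elim/mpolyind: p => [|c m p _ _ IH].
  by rewrite comp_mpoly0 mderiv0 big1 // => i _; rewrite mderiv0 comp_mpoly0 mul0r.
rewrite comp_mpolyD comp_mpolyZ mderivD mderivZ DX IH scaler_sumr -big_split /=.
apply: eq_bigr => i _.
by rewrite mderivD mderivZ comp_mpolyD comp_mpolyZ mulrDl scalerAl.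
Qed.

Lemma comp_mpoly_comp l (lr : k.-tuple {mpoly R[l]}) (p : {mpoly R[n]}) :
  (p \mPo lq) \mPo lr = p \mPo [tuple (tnth lq i) \mPo lr | i < n].
Proof.
rewrite (comp_mpolyE p lq) raddf_sum comp_mpolyE; apply: eq_bigr => m _ /=.
rewrite comp_mpolyZ rmorph_prod; congr (_ *: _); apply: eq_bigr => i _ /=.
by rewrite rmorphXn tnth_mktuple.
Qed.

End Composition.

Lemma mderivUX (R : nzRingType) n (i j : 'I_n) k :
  ('X_i ^+ k : {mpoly R[n]})^`M(j) = (i == j)%:R * 'X_i ^+ k.-1 *+ k.
Proof.
elim: k => [|k IH]; first by rewrite expr0 -mpolyC1 mderivC.
rewrite exprS mderivM mderivU IH /=; case: eqP => _; last first.
  by rewrite !mul0r mul0rn mulr0 addr0 mul0rn.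
case: k {IH} => [|k]; first by rewrite !mulr0n mulr0 addr0.
by rewrite !mul1r /= mulrnAr -exprS -mulrS.
Qed.

(** * Transvectants of binary forms in terms of coefficients *)

Section Transvectants.
Variable R : comUnitRingType.

Let emb1 (F : {mpoly R[2]}) : {mpoly R[4]} := F \mPo [tuple 'X_0; 'X_1].
Let emb2 (F : {mpoly R[2]}) : {mpoly R[4]} := F \mPo [tuple 'X_2; 'X_3].

(** The unnormalized transvectant, computed in two variables without the detour through four. *)
Fixpoint omega_iter k (F G : {mpoly R[2]}) : {mpoly R[2]} :=
  if k is k'.+1 then
    omega_iter k' F^`M(0) G^`M(1) - omega_iter k' F^`M(1) G^`M(0)
  else F * G.

Let mderiv_emb1 F :
  [/\ (emb1 F)^`M(0) = emb1 F^`M(0), (emb1 F)^`M(1) = emb1 F^`M(1),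
      (emb1 F)^`M(2) = 0 & (emb1 F)^`M(3) = 0].
Proof.
have E : lift ord0 ord0 = 1 :> 'I_2 by apply: val_inj.
by split; rewrite mderiv_comp_mpoly !big_ord_recl big_ord0 /= !(tnth0, tnthS)
  !mderivU ?mulr0 ?mulr1 ?addr0 ?add0r // E.
Qed.

Let mderiv_emb2 F :
  [/\ (emb2 F)^`M(0) = 0, (emb2 F)^`M(1) = 0,
      (emb2 F)^`M(2) = emb2 F^`M(0) & (emb2 F)^`M(3) = emb2 F^`M(1)].
Proof.
have E : lift ord0 ord0 = 1 :> 'I_2 by apply: val_inj.
by split; rewrite mderiv_comp_mpoly !big_ord_recl big_ord0 /= !(tnth0, tnthS)
  !mderivU ?mulr0 ?mulr1 ?addr0 ?add0r // E.
Qed.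

Let cayley_omegaM F G :
  cayley_omega (emb1 F * emb2 G) =
  emb1 F^`M(0) * emb2 G^`M(1) - emb1 F^`M(1) * emb2 G^`M(0).
Proof.
have [F0 F1 F2 F3] := mderiv_emb1 F; have [G0 G1 G2 G3] := mderiv_emb2 G.
have [F00 F01 F02 F03] := mderiv_emb1 F^`M(0).
have [F10 F11 F12 F13] := mderiv_emb1 F^`M(1).
by rewrite /cayley_omega !mderivM F0 F1 G0 G1 !mulr0 !addr0 !mderivM F03 F12
  !mul0r !add0r G2 G3.
Qed.

Lemma iter_cayleyB k P Q :
  iter k (@cayley_omega R) (P - Q) =
  iter k (@cayley_omega R) P - iter k (@cayley_omega R) Q.
Proof.
by elim: k P Q => //= k IH P Q; rewrite IH /cayley_omega !mderivB; ring.
Qed.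

Lemma iter_cayley_comp k F G :
  iter k (@cayley_omega R) (emb1 F * emb2 G)
    \mPo [tuple 'X_0; 'X_1; 'X_0; 'X_1] =
  omega_iter k F G.
Proof.
elim: k F G => [|k IH] F G.
  (* Identifying the two pairs of variables turns both embeddings into the identity substitution. *)
  have id2 (t : 2.-tuple {mpoly R[2]}) : tnth t 0 = 'X_0 -> tnth t 1 = 'X_1 ->
      forall p, p \mPo t = p.
    move=> t0 t1 p; rewrite -[RHS]comp_mpoly_id; congr (_ \mPo _).
    apply: eq_from_tnth => i; rewrite tnth_mktuple.
    by case: i => [[|[|//]] lti]; [rewrite -[RHS]t0 | rewrite -[RHS]t1];
      congr (tnth _ _); apply: val_inj.
  rewrite /= rmorphM /= !comp_mpoly_comp.
  by congr (_ * _); apply: id2; rewrite tnth_mktuple comp_mpolyXU.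
(* The innermost Omega is expanded first: it yields a difference of two separated products, and the
   induction hypothesis covers each. *)
by rewrite iterSr cayley_omegaM iter_cayleyB rmorphB /= !IH.
Qed.

Lemma transvectantE m n k F G :
  transvectant m n k F G =
  (((m - k)`! * (n - k)`!)%:R / (m`! * n`!)%:R) *: omega_iter k F G.
Proof. by rewrite -iter_cayley_comp. Qed.

(** The coefficients carry no binomial factors. Indexing them by all of [nat] makes the y-derivative
    a weighted shift without bounds to check; entries past [d] are ignored. *)
Definition bform d (a : nat -> R) : {mpoly R[2]} :=
  \sum_(i < d.+1) a i *: ('X_0 ^+ (d - i) * 'X_1 ^+ i).

Lemma bform_dx d a : (bform d.+1 a)^`M(0) = bform d (fun i => a i *+ (d.+1 - i)).
Proof.
rewrite /bform big_ord_recr /= raddfD raddf_sum /=.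
rewrite mderivZ subnn expr0 mul1r mderivUX mul0r mul0rn scaler0 addr0.
apply: eq_bigr => i _; rewrite mderivZ mderivM !mderivUX /= mul0r mul0rn mulr0.
by rewrite addr0 mul1r mulrnAl -scalerMnr scalerMnl subSn ?leq_ord.
Qed.

Lemma bform_dy d a : (bform d.+1 a)^`M(1) = bform d (fun i => a i.+1 *+ i.+1).
Proof.
rewrite /bform big_ord_recl /= raddfD raddf_sum /=.
rewrite mderivZ expr0 mulr1 mderivUX mul0r mul0rn scaler0 add0r.
apply: eq_bigr => i _; rewrite mderivZ mderivM !mderivUX /= mul0r mul0rn mul0r.
by rewrite add0r mul1r mulrnAr -scalerMnr scalerMnl subSS.
Qed.

(** The same recursion on coefficients for two forms of degree [k]: each step lowers both degrees by
    one, so [k] steps end at constants. *)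
Fixpoint omega_coef k (a b : nat -> R) : R :=
  if k is k'.+1 then
    omega_coef k' (fun i => a i *+ (k - i)) (fun i => b i.+1 *+ i.+1)
    - omega_coef k' (fun i => a i.+1 *+ i.+1) (fun i => b i *+ (k - i))
  else a 0%N * b 0%N.

Lemma omega_iter_bform k a b :
  omega_iter k (bform k a) (bform k b) = (omega_coef k a b)%:MP.
Proof.
elim: k a b => [|k IH] a b; last by rewrite /= !bform_dx !bform_dy !IH -mpolyCB.
by rewrite /bform /= !big_ord1 !expr0 mulr1 -!mul_mpolyC !mulr1 -mpolyCM.
Qed.
Lemma bformZ d c (a : nat -> R) : c *: bform d a = bform d (fun i => c * a i).
Proof. by rewrite scaler_sumr; apply: eq_bigr => i _; rewrite scalerA. Qed.

Lemma bformB d (a b : nat -> R) :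
  bform d a - bform d b = bform d (fun i => a i - b i).
Proof. by rewrite /bform -sumrB; apply: eq_bigr => i _; rewrite scalerBl. Qed.

Lemma bform2M (a b : nat -> R) : bform 2 a * bform 2 b =
  bform 4 (nth 0
    [:: a 0%N * b 0%N; a 0%N * b 1%N + a 1%N * b 0%N;
        a 0%N * b 2%N + a 1%N * b 1%N + a 2%N * b 0%N;
        a 1%N * b 2%N + a 2%N * b 1%N; a 2%N * b 2%N]).
Proof.
by rewrite /bform !big_ord_recl !big_ord0 /= /bump /= -!mul_mpolyC; ring.
Qed.

Lemma eq_bform d (a b : nat -> R) :
  (forall i, (i <= d)%N -> a i = b i) -> bform d a = bform d b.
Proof. by move=> eq_ab; apply: eq_bigr => i _; rewrite eq_ab ?leq_ord. Qed.

(** This is twice the Hessian determinant of the quartic, since Omega squared gives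
    [F_xx G_yy - 2 F_xy G_xy + F_yy G_xx]. *)
Lemma omega_iter2_quartic (a : nat -> R) :
  omega_iter 2 (bform 4 a) (bform 4 a) = 6 *: bform 4 (nth 0
    [:: 8 * a 0%N * a 2%N - 3 * a 1%N ^+ 2; 24 * a 0%N * a 3%N - 4 * a 1%N * a 2%N;
        48 * a 0%N * a 4%N + 6 * a 1%N * a 3%N - 4 * a 2%N ^+ 2;
        24 * a 1%N * a 4%N - 4 * a 2%N * a 3%N; 8 * a 2%N * a 4%N - 3 * a 3%N ^+ 2]).
Proof.
rewrite /= !(bform_dx, bform_dy) !bform2M !bformB bformZ.
by apply: eq_bform; do 5![case=> [_ /=|]; first by rewrite !(subSS, subn0); ring].
Qed.

(** The apolar pairing of two quartics: [a_i b_(4-i)] has weight [(-1)^i i! (4-i)!], with an overall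
    factor 4!. *)
Lemma omega_coef4 (a b : nat -> R) : omega_coef 4 a b =
  24 * (24 * a 0%N * b 4%N - 6 * a 1%N * b 3%N + 4 * a 2%N * b 2%N
        - 6 * a 3%N * b 1%N + 24 * a 4%N * b 0%N).
Proof. by rewrite /= !(subSS, subn0); ring. Qed.

End Transvectants.

(** * The invariants Sigma and Psi of a binary quartic *)

Section InvariantsOfQuartic.
Variables (K : numFieldType) (n : nat) (a : nat -> {mpoly K[n]}).

(** The normalizing quotients are formed in the polynomial ring; they are moved into the field [K],
    where they can be evaluated. *)
Let natV m : (m%:R : {mpoly K[n]})^-1 = (m%:R^-1)%:MP.
Proof. by rewrite -mpolyC_nat fmorphV. Qed.
Let natdiv k m : (k%:R / m%:R : {mpoly K[n]}) = (k%:R / m%:R)%:MP.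
Proof. by rewrite natV -mpolyC_nat -mpolyCM. Qed.

Lemma quartic_Sigma_bform : quartic_Sigma (bform 4 a) =
  12^-1 *: (12 * a 0%N * a 4%N - 3 * a 1%N * a 3%N + a 2%N ^+ 2).
Proof.
rewrite /quartic_Sigma transvectantE omega_iter_bform omega_coef4.
rewrite mcoeffZ mcoeffC eqxx mulr1 -mul_mpolyC !natdiv (natV _).
(* For [b = a] the pairing is 24 times 4 times the stated quadratic expression, whence 96. *)
have -> : (12^-1 : K) = 2^-1 * (((4 - 4)`! * (4 - 4)`!)%:R / (4`! * 4`!)%:R) * 96.
  by rewrite !factS fact0; field.
by ring.
Qed.

Lemma quartic_Psi_bform : quartic_Psi (bform 4 a) =
  432^-1 *: (72 * a 0%N * a 2%N * a 4%N - 27 * a 0%N * a 3%N ^+ 2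
             - 27 * a 1%N ^+ 2 * a 4%N + 9 * a 1%N * a 2%N * a 3%N - 2 * a 2%N ^+ 3).
Proof.
rewrite /quartic_Psi !transvectantE omega_iter2_quartic !bformZ.
rewrite omega_iter_bform omega_coef4 mcoeffZ mcoeffC eqxx mulr1 -mul_mpolyC !natdiv (natV _).
(* Here 1152 is 6 * 24 * 8: 6 from the second transvectant, 24 from the pairing, and 8 common to the
   resulting cubic expression. *)
have -> : (432^-1 : K) = 6^-1 * (((4 - 4)`! * (4 - 4)`!)%:R / (4`! * 4`!)%:R)
    * (((4 - 2)`! * (4 - 2)`!)%:R / (4`! * 4`!)%:R) * 1152.
  by rewrite !factS fact0; field.
by move: (6^-1) (_ / _) (_ / _) => u v w /=; ring.
Qed.

End InvariantsOfQuartic.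

(** * The restriction of X16 to a variable line *)

Section LineSection.
Variables (K : numFieldType) (r s : K).

Let L := @line_section K.
Let LD f g : L (f + g) = L f + L g.
Proof. by rewrite /L /line_section raddfD comp_mpolyD. Qed.
Let LM f g : L (f * g) = L f * L g.
Proof. by rewrite /L /line_section rmorphM /= rmorphM. Qed.
Let LX f k : L (f ^+ k) = L f ^+ k.
Proof. by rewrite /L /line_section rmorphXn /= rmorphXn. Qed.
Let LZ c f : L (c *: f) = c%:MP%:MP * L f.
Proof. by rewrite /L /line_section map_mpolyZ comp_mpolyZ mul_mpolyC. Qed.
Let L0 : L 'X_0 = 'X_0.
Proof. by rewrite /L /line_section map_mpolyX comp_mpolyXU. Qed.
Let L1 : L 'X_1 = 'X_1.
Proof. by rewrite /L /line_section map_mpolyX comp_mpolyXU. Qed.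
Let L2 : L 'X_2 = - (('X_0)%:MP * 'X_0) - ('X_1)%:MP * 'X_1.
Proof. by rewrite /L /line_section map_mpolyX comp_mpolyXU /= !mul_mpolyC. Qed.

(** Restriction is a ring morphism, so its values on scalars and on the three variables determine
    the section. *)
Lemma line_section_X16 : line_section (X16 r s) = bform 4 (nth 0
  (let a : {mpoly K[2]} := 'X_0 in let b : {mpoly K[2]} := 'X_1 in
  [:: 1 + s%:MP * a ^+ 2 + a ^+ 4; 2 * s%:MP * a * b + 4 * a ^+ 3 * b;
    r%:MP + s%:MP * (a ^+ 2 + b ^+ 2) + 6 * a ^+ 2 * b ^+ 2;
    2 * s%:MP * a * b + 4 * a * b ^+ 3; 1 + s%:MP * b ^+ 2 + b ^+ 4])).
Proof.
rewrite -/L /X16 !(LD, LZ, LM, LX, L0, L1, L2).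
rewrite /bform !big_ord_recl big_ord0 /= /bump /= !(subSS, subn0).
by rewrite -!mul_mpolyC; ring.
Qed.

End LineSection.

(** * Determinants and adjugates of order 3 *)

Lemma ord3_cases (h : 'I_3) : [\/ h = 0, h = 1 | h = 2].
Proof.
by case: h => [[|[|[|//]]] lth]; [apply: Or31 | apply: Or32 | apply: Or33];
  apply: val_inj.
Qed.

Section Det3.
Variable R : comNzRingType.

Lemma big_ord3 (F : 'I_3 -> R) : \sum_i F i = F 0 + F 1 + F 2.
Proof.
rewrite !big_ord_recl big_ord0 addr0 addrA.
by congr (F _ + F _ + F _); apply: val_inj.
Qed.

Lemma det_mx22 (A : 'M[R]_2) : \det A = A 0 0 * A 1 1 - A 0 1 * A 1 0.
Proof.
rewrite (expand_det_row _ 0) !big_ord_recl big_ord0 /cofactor !det_mx11 !mxE /=.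
rewrite !(mul1r, addr0, expr0, expr1) mulN1r mulrN.
by congr (_ * A _ _ - A _ _ * A _ _); apply: val_inj.
Qed.

Fact lift3E :
  (lift (0 : 'I_3) (0 : 'I_2) = 1) * (lift (0 : 'I_3) (1 : 'I_2) = 2) *
  (lift (1 : 'I_3) (0 : 'I_2) = 0) * (lift (1 : 'I_3) (1 : 'I_2) = 2) *
  (lift (2 : 'I_3) (0 : 'I_2) = 0) * (lift (2 : 'I_3) (1 : 'I_2) = 1).
Proof. by do !split; apply: val_inj. Qed.

Lemma det_mx33 (A : 'M[R]_3) : \det A =
  A 0 0 * (A 1 1 * A 2 2 - A 1 2 * A 2 1) - A 0 1 * (A 1 0 * A 2 2 - A 1 2 * A 2 0)
  + A 0 2 * (A 1 0 * A 2 1 - A 1 1 * A 2 0).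
Proof.
rewrite (expand_det_row _ 0) big_ord3 /cofactor !det_mx22 !mxE.
by rewrite !lift3E /=; ring.
Qed.

Lemma adj_diag_mx3 (d : 'rV[R]_3) : \adj (diag_mx d) = diag_mx (\row_i
  [:: d 0 1 * d 0 2; d 0 0 * d 0 2; d 0 0 * d 0 1]`_i).
Proof.
apply/matrixP => i j; rewrite !mxE /cofactor det_mx22 !mxE.
case: (ord3_cases i) => ->; case: (ord3_cases j) => ->;
  by rewrite !lift3E /=; ring.
Qed.

Lemma mxpair_diag n (d e : 'rV[R]_n) :
  mxpair (diag_mx d) (diag_mx e) = \sum_i d 0 i * e 0 i.
Proof.
apply: eq_bigr => i _; rewrite (bigD1 i) //= big1 ?addr0 => [|j ij].
  by rewrite !mxE eqxx.
by rewrite !mxE eq_sym (negPf ij) mul0r.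
Qed.

End Det3.

(** * Ternary polynomials given by lists of terms *)

Section Poly3.
Variable K : fieldType.
Implicit Types (f g : {mpoly K[3]}).

Definition monom3 (e : nat * nat * nat) : {mpoly K[3]} :=
  'X_0 ^+ e.1.1 * 'X_1 ^+ e.1.2 * 'X_2 ^+ e.2.

(** Exponents may repeat and coefficients may vanish, so the differential operators act on lists
    without any normalization. *)
Definition poly3 (l : seq (K * (nat * nat * nat))) : {mpoly K[3]} :=
  \sum_(t <- l) t.1 *: monom3 t.2.

Definition poly2 (l : seq (K * (nat * nat))) : {mpoly K[2]} :=
  \sum_(t <- l) t.1 *: ('X_0 ^+ t.2.1 * 'X_1 ^+ t.2.2).

Lemma homogenizeE d (p : {mpoly K[2]}) : homogenize d p =
  monomial_ext (fun m => 'X_0 ^+ m 0 * 'X_1 ^+ m 1 * 'X_2 ^+ (d - mdeg m)) p.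
Proof. by []. Qed.

Lemma diffopE f g : diffop f g = monomial_ext (fun m => g^`M[m]) f.
Proof. by []. Qed.

Lemma homogenizeZ d c (p : {mpoly K[2]}) :
  homogenize d (c *: p) = c *: homogenize d p.
Proof. by rewrite !homogenizeE linearZ. Qed.

Definition homogenize_seq d (l : seq (K * (nat * nat))) :=
  [seq (t.1, (t.2.1, t.2.2, d - (t.2.1 + t.2.2))%N) | t <- l].

Lemma homogenize_poly2 d l :
  homogenize d (poly2 l) = poly3 (homogenize_seq d l).
Proof.
rewrite /poly3 /poly2 big_map homogenizeE raddf_sum.
apply: eq_bigr => -[c [i j]] _ /=.
rewrite linearZ /=; congr (_ *: _).
have -> : 'X_0 ^+ i * 'X_1 ^+ j = 'X_[U_(0) *+ i + U_(1) *+ j] :> {mpoly K[2]}.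
  by rewrite !mpolyXn mpolyXD.
rewrite monomial_extX mdegD !mdegMn !mdeg1 !mul1n.
by rewrite /monom3 !mnmDE !mulmnE !mnm1E /= !mul1n !mul0n addn0 add0n.
Qed.

Lemma diffopZl c f g : diffop (c *: f) g = c *: diffop f g.
Proof. by rewrite !diffopE linearZ. Qed.

Lemma diffopZr c f g : diffop f (c *: g) = c *: diffop f g.
Proof.
rewrite /diffop scaler_sumr; apply: eq_bigr => m _.
by rewrite mderivmZ !scalerA mulrC.
Qed.

(** If an exponent of [e] exceeds that of [e'], its falling factorial is zero, so the truncated
    subtraction does no harm. *)
Lemma diffop_monom3 e e' :
  diffop (monom3 e) (monom3 e') =
  (e'.1.1 ^_ e.1.1 * e'.1.2 ^_ e.1.2 * e'.2 ^_ e.2)%:R *: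
  monom3 (e'.1.1 - e.1.1, e'.1.2 - e.1.2, e'.2 - e.2)%N.
Proof.
case: e e' => [[a b] c] [[i j] k] /=.
have M x y z : monom3 (x, y, z) = 'X_[U_(0) *+ x + U_(1) *+ y + U_(2) *+ z].
  by rewrite !mpolyXD -!mpolyXn.
have mE x y z h : (U_(0%R) *+ x + U_(1) *+ y + U_(2) *+ z : 'X_{1..3})%MM h =
    [:: x; y; z]`_h.
  rewrite !mnmDE !mulmnE !mnm1E.
  by case: h => [[|[|[|//]]] lth];
    rewrite /= ?(mul1n, mul0n, muln0, add0n, addn0).
rewrite !M diffopE monomial_extX mderivmX !big_ord_recl big_ord0 /= muln1.
rewrite !mE /= mulnA; congr (_ *: 'X_[_]); apply/mnmP => h.
by rewrite mnmBE !mE; case: h => [[|[|[|//]]] lth].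
Qed.

Lemma diffop_sumr (T : Type) (l : seq T) f (F : T -> {mpoly K[3]}) :
  diffop f (\sum_(u <- l) F u) = \sum_(u <- l) diffop f (F u).
Proof.
rewrite /diffop exchange_big; apply: eq_bigr => m _.
by rewrite raddf_sum scaler_sumr.
Qed.

Definition diffop_seq (l1 l2 : seq (K * (nat * nat * nat))) :=
  [seq (t.1 * u.1 *+
          (u.2.1.1 ^_ t.2.1.1 * u.2.1.2 ^_ t.2.1.2 * u.2.2 ^_ t.2.2),
        (u.2.1.1 - t.2.1.1, u.2.1.2 - t.2.1.2, u.2.2 - t.2.2)%N)
     | t <- l1, u <- l2].

Lemma diffop_poly3 l1 l2 :
  diffop (poly3 l1) (poly3 l2) = poly3 (diffop_seq l1 l2).
Proof.
rewrite {1 3}/poly3 diffopE raddf_sum big_allpairs_dep.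
apply: eq_bigr => t _ /=.
rewrite -diffopE diffop_sumr; apply: eq_bigr => u _.
by rewrite diffopZl diffopZr diffop_monom3 !scalerA mulr_natr.
Qed.

Definition expn_pair (i j : 'I_3) : nat * nat * nat :=
  ((i == 0%R) + (j == 0%R), (i == 1%R) + (j == 1%R),
   (i == 2%R) + (j == 2%R))%N.

Lemma expn_pairE :
  (expn_pair 0 0 = (2, 0, 0)%N) * (expn_pair 1 1 = (0, 2, 0)%N) *
  (expn_pair 2 2 = (0, 0, 2)%N) * (expn_pair 0 1 = (1, 1, 0)%N) *
  (expn_pair 0 2 = (1, 0, 1)%N) * (expn_pair 1 2 = (0, 1, 1)%N) *
  (expn_pair 1 0 = (1, 1, 0)%N) * (expn_pair 2 0 = (1, 0, 1)%N) *
  (expn_pair 2 1 = (0, 1, 1)%N).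
Proof. by []. Qed.

(* The (i, j) entry of the Hessian is D_f for the monomial f = x_i x_j. *)
Lemma hessian_poly3 l i j :
  hessian (poly3 l) i j = poly3 (diffop_seq [:: (1, expn_pair i j)] l).
Proof.
rewrite mxE -diffop_poly3 /poly3 big_seq1 scale1r.
have -> : monom3 (expn_pair i j) = 'X_[U_(i) + U_(j)].
  rewrite mpolyXD /monom3.
  by case: (ord3_cases i) => ->; case: (ord3_cases j) => ->;
    rewrite expn_pairE /=; ring.
by rewrite diffopE monomial_extX mderivmDm !mderivmU1m.
Qed.

Lemma poly3_foldr l :
  poly3 l = foldr (fun t p => t.1%:MP * monom3 t.2 + p) 0 l.
Proof.
rewrite /poly3; elim: l => [|t l IH]; first by rewrite big_nil.
by rewrite big_cons /= IH mul_mpolyC.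
Qed.

Lemma poly2_foldr l :
  poly2 l =
  foldr (fun t p => t.1%:MP * ('X_0 ^+ t.2.1 * 'X_1 ^+ t.2.2) + p) 0 l.
Proof.
rewrite /poly2; elim: l => [|t l IH]; first by rewrite big_nil.
by rewrite big_cons /= IH mul_mpolyC.
Qed.

End Poly3.

(* simpl would also unfold Nat.of_num_uint, which represents the numerals above
   5000, hence the explicit list of constants. *)
Ltac poly_ring :=
  rewrite ?poly3_foldr ?poly2_foldr;
  cbv [diffop_seq homogenize_seq map allpairs_dep flatten foldr cat fst snd
    monom3 falling_factorial ffact_rec muln muln_rec addn addn_rec subn subn_rec
    Nat.add Nat.mul Nat.sub Nat.pred predn];
  rewrite -?mul_mpolyC; ring.


(** * Diagonal quadratic forms and their joint invariants *)

Section Quad.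
Variable K : fieldType.

Definition quad (a b c : K) : {mpoly K[3]} :=
  poly3 [:: (a, (2, 0, 0)%N); (b, (0, 2, 0)%N); (c, (0, 0, 2)%N)].

Lemma quadZ k a b c : k *: quad a b c = quad (k * a) (k * b) (k * c).
Proof. by rewrite /quad; poly_ring. Qed.

Lemma hessian_quad a b c :
  hessian (quad a b c) = diag_mx (\row_i (2 * [:: a; b; c]`_i)%:MP).
Proof.
apply/matrixP => i j; rewrite hessian_poly3 !mxE.
by case: (ord3_cases i) => ->; case: (ord3_cases j) => ->;
  rewrite expn_pairE /=; poly_ring.
Qed.

Lemma det_hessian_quad a b c : \det (hessian (quad a b c)) = (8 * a * b * c)%:MP.
Proof. by rewrite hessian_quad det_mx33 !mxE /=; ring. Qed.

Lemma J11_quad a b c a' b' c' :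
  J11 (quad a b c) (quad a' b' c') = (4 * (a * a' + b * b' + c * c'))%:MP.
Proof. by rewrite /J11 !hessian_quad mxpair_diag big_ord3 !mxE /=; ring. Qed.

Lemma J22_quad a b c a' b' c' :
  J22 (quad a b c) (quad a' b' c') =
  (16 * (b * c * b' * c' + a * c * a' * c' + a * b * a' * b'))%:MP.
Proof.
by rewrite /J22 !hessian_quad !adj_diag_mx3 mxpair_diag big_ord3 !mxE /=; ring.
Qed.

End Quad.

(** * The covariants of X16 *)

Section X16Forms.
Variables (K : numFieldType) (r s : K).

Definition X16_coefs : seq (K * (nat * nat * nat)) :=
  [:: (1, (4, 0, 0)%N); (1, (0, 4, 0)%N); (1, (0, 0, 4)%N);
      (r, (2, 2, 0)%N); (s, (0, 2, 2)%N); (s, (2, 0, 2)%N)].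

Lemma X16_poly3 : X16 r s = poly3 X16_coefs.
Proof. by rewrite /X16 /X16_coefs /=; poly_ring. Qed.

Definition sigma_coefs : seq (K * (nat * nat)) :=
  [:: (s ^+ 2 + 12, (4, 0)%N); (12 * r + 2 * s ^+ 2, (2, 2)%N);
      (2 * r * s + 12 * s, (2, 0)%N); (s ^+ 2 + 12, (0, 4)%N);
      (2 * r * s + 12 * s, (0, 2)%N); (r ^+ 2 + 12, (0, 0)%N)].

Lemma sigma_X16 :
  sigma_form (X16 r s) = 12^-1 *: poly3 (homogenize_seq 4 sigma_coefs).
Proof.
rewrite /sigma_form line_section_X16 quartic_Sigma_bform homogenizeZ.
rewrite -homogenize_poly2; congr (_ *: homogenize _ _).
by rewrite /sigma_coefs /=; poly_ring.
Qed.

Definition psi_coefs : seq (K * (nat * nat)) :=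
  [:: (- s ^+ 3 + 36 * s, (6, 0)%N);
      (36 * r * s - 3 * s ^+ 3 + 36 * s, (4, 2)%N);
      (- 3 * r * s ^+ 2 + 36 * r + 36 * s ^+ 2, (4, 0)%N);
      (36 * r * s - 3 * s ^+ 3 + 36 * s, (2, 4)%N);
      (- 18 * r ^+ 2 + 48 * r * s ^+ 2 - 36 * s ^+ 2 + 216, (2, 2)%N);
      (- 3 * r ^+ 2 * s + 36 * r * s + 36 * s, (2, 0)%N);
      (- s ^+ 3 + 36 * s, (0, 6)%N);
      (- 3 * r * s ^+ 2 + 36 * r + 36 * s ^+ 2, (0, 4)%N);
      (- 3 * r ^+ 2 * s + 36 * r * s + 36 * s, (0, 2)%N);
      (- r ^+ 3 + 36 * r, (0, 0)%N)].

Lemma psi_X16 :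
  psi_form (X16 r s) = 216^-1 *: poly3 (homogenize_seq 6 psi_coefs).
Proof.
rewrite /psi_form line_section_X16 quartic_Psi_bform homogenizeZ.
rewrite -homogenize_poly2.
(* Every coefficient of 432 Psi of the section is even, because [a1] and [a3] are; the factor 2 is
   taken out. *)
rewrite -[X in _ = X *: _](_ : 432^-1 * 2 = _); last by field.
rewrite -scalerA -[in RHS]homogenizeZ; congr (_ *: homogenize _ _).
by rewrite /psi_coefs /=; poly_ring.
Qed.

Definition rho_x : K :=
  30 * r ^+ 2 * s + 2 * r * s ^+ 3 + 144 * r * s + 12 * s ^+ 3 + 648 * s.
Definition rho_z : K :=
  - 18 * r ^+ 3 + 2 * r ^+ 2 * s ^+ 2 + 60 * r * s ^+ 2 + 648 * r
  + 144 * s ^+ 2.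

Lemma rho_X16 : rho_form (X16 r s) = 9^-1 *: quad rho_x rho_x rho_z.
Proof.
rewrite /rho_form psi_X16 diffopZr X16_poly3 diffop_poly3.
(* 24 is a common factor of the coefficients produced by the differentiation. *)
rewrite -[X in _ = X *: _](_ : 216^-1 * 24 = _); last by field.
rewrite -scalerA; congr (_ *: _).
by rewrite /X16_coefs /psi_coefs /quad /rho_x /rho_z; poly_ring.
Qed.

Definition tau_x : K :=
  24 * r ^+ 3 * s + 8 * r ^+ 2 * s ^+ 3 + 648 * r ^+ 2 * s + 168 * r * s ^+ 3
  + 4320 * r * s + 432 * s ^+ 3 + 7776%:R * s.
Definition tau_z : K :=
  - 216 * r ^+ 3 + 144 * r ^+ 2 * s ^+ 2 + 8 * r * s ^+ 4 + 1296 * r * s ^+ 2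
  + 7776%:R * r + 48 * s ^+ 4 + 4320 * s ^+ 2.

Lemma tau_X16 : tau_form (X16 r s) = 9^-1 *: quad tau_x tau_x tau_z.
Proof.
rewrite /tau_form rho_X16 diffopZl X16_poly3 diffop_poly3; congr (_ *: _).
by rewrite /X16_coefs /quad /rho_x /rho_z /tau_x /tau_z; poly_ring.
Qed.

Definition hessian_coefs : seq (K * (nat * nat * nat)) :=
  [:: (48 * r * s, (6, 0, 0)%N);
      (- 24 * r ^+ 2 * s + 48 * r * s + 288 * s, (4, 2, 0)%N);
      (- 24 * r * s ^+ 2 + 288 * r + 48 * s ^+ 2, (4, 0, 2)%N);
      (- 24 * r ^+ 2 * s + 48 * r * s + 288 * s, (2, 4, 0)%N);
      (- 144 * r ^+ 2 + 144 * r * s ^+ 2 - 288 * s ^+ 2 + 1728, (2, 2, 2)%N);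
      (48 * r * s - 24 * s ^+ 3 + 288 * s, (2, 0, 4)%N);
      (48 * r * s, (0, 6, 0)%N);
      (- 24 * r * s ^+ 2 + 288 * r + 48 * s ^+ 2, (0, 4, 2)%N);
      (48 * r * s - 24 * s ^+ 3 + 288 * s, (0, 2, 4)%N);
      (48 * s ^+ 2, (0, 0, 6)%N)].

Lemma det_hessian_X16 : \det (hessian (X16 r s)) = poly3 hessian_coefs.
Proof.
rewrite X16_poly3 det_mx33 !hessian_poly3 !expn_pairE.
by rewrite /hessian_coefs /X16_coefs; poly_ring.
Qed.

(** Extracts the denominator of sigma or psi from the expected value, which leaves an identity free
    of division. *)
Let mpolyC_scale (k c : K) : k != 0 -> c%:MP = k^-1 *: (k * c)%:MP :> {mpoly K[3]}.
Proof. by move=> k0; rewrite -mul_mpolyC -mpolyCM mulKf. Qed.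

Lemma I3_X16 : dixmier_I3 (X16 r s) =
  (2 * (r * s ^+ 2 + 6 * s ^+ 2 + 3 * r ^+ 2 + 36))%:MP.
Proof.
rewrite /dixmier_I3 sigma_X16 diffopZl X16_poly3 diffop_poly3.
rewrite [RHS](@mpolyC_scale 12) ?Num.Theory.pnatr_eq0 //; congr (_ *: _).
by rewrite /X16_coefs /sigma_coefs; poly_ring.
Qed.

Lemma diffop_psi_hessian :
  diffop (psi_form (X16 r s)) (\det (hessian (X16 r s))) =
  (96 * r ^+ 4 - 960 * r ^+ 3 * s ^+ 2 + 352 * r ^+ 2 * s ^+ 4
   + 384 * r ^+ 2 * s ^+ 2 + 2304 * r ^+ 2 - 1920 * r * s ^+ 4
   + 37632%:R * r * s ^+ 2 + 384 * s ^+ 4 + 4608 * s ^+ 2 + 13824%:R)%:MP.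
Proof.
rewrite psi_X16 det_hessian_X16 diffopZl diffop_poly3.
rewrite [RHS](@mpolyC_scale 216) ?Num.Theory.pnatr_eq0 //.
apply: (congr1 ( *:%R _)).
by rewrite /psi_coefs /hessian_coefs; poly_ring.
Qed.

End X16Forms.

(* algC, the type of algebraic complex numbers, is the algebraic closure of the
   rationals. *)
Theorem proposition2p2 (r s : algC) :
  [/\ dixmier_I3 (X16 r s) =
        (2 * (r * s ^+ 2 + 6 * s ^+ 2 + 3 * r ^+ 2 + 36))%:MP,
      dixmier_I6 (X16 r s) =
        (1 / 648 *
          (228095%:R * r ^+ 2 * s ^+ 4 - 1244172%:R * r * s ^+ 4 + 248796%:R * s ^+ 4
           - 622086%:R * r ^+ 3 * s ^+ 2 + 248796%:R * r ^+ 2 * s ^+ 2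
           + 24385464%:R * r * s ^+ 2 + 2985552%:R * s ^+ 2 + 62199%:R * r ^+ 4
           + 1492776%:R * r ^+ 2 + 8956656%:R))%:MP,
      dixmier_I9 (X16 r s) =
        (64 / 27 *
          (r ^+ 3 * s ^+ 6 + 30 * r ^+ 2 * s ^+ 6 + 204 * r * s ^+ 6
           + 360 * s ^+ 6 + 15 * r ^+ 4 * s ^+ 4 + 540 * r ^+ 3 * s ^+ 4
           + 4788 * r ^+ 2 * s ^+ 4 + 19872%:R * r * s ^+ 4 + 28512%:R * s ^+ 4
           - 33 * r ^+ 5 * s ^+ 2 + 198 * r ^+ 4 * s ^+ 2
           + 9936%:R * r ^+ 3 * s ^+ 2 + 80352%:R * r ^+ 2 * s ^+ 2
           + 244944%:R * r * s ^+ 2 + 209952%:R * s ^+ 2 + 81 * r ^+ 6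
           - 5832%:R * r ^+ 4 + 104976%:R * r ^+ 2))%:MP
    & [/\ dixmier_I12 (X16 r s) =
        (64 / 729 * s ^+ 2
         * (r * s ^+ 2 + 6 * s ^+ 2 + 15 * r ^+ 2 + 72 * r + 324) ^+ 2
         * (r ^+ 2 * s ^+ 2 + 30 * r * s ^+ 2 + 72 * s ^+ 2 - 9 * r ^+ 3
            + 324 * r))%:MP,
      dixmier_I15 (X16 r s) =
        (4096 / 729 * (r + 3) ^+ 2 * (r + 18) ^+ 2 * s ^+ 2
         * (s ^+ 2 + 3 * r + 18) ^+ 2
         * (r * s ^+ 4 + 6 * s ^+ 4 + 18 * r ^+ 2 * s ^+ 2 + 162 * r * s ^+ 2
            + 540 * s ^+ 2 - 27 * r ^+ 3 + 972 * r))%:MP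
    & dixmier_I18 (X16 r s) =
        (4096 / 2187 * (r + 3) * (r + 18) * s ^+ 2 * (s ^+ 2 + 3 * r + 18)
         * (r * s ^+ 2 + 6 * s ^+ 2 + 15 * r ^+ 2 + 72 * r + 324)
         * (r ^+ 3 * s ^+ 6 + 33 * r ^+ 2 * s ^+ 6 + 228 * r * s ^+ 6
            + 396 * s ^+ 6 + 12 * r ^+ 4 * s ^+ 4 + 594 * r ^+ 3 * s ^+ 4
            + 5904%:R * r ^+ 2 * s ^+ 4 + 24840%:R * r * s ^+ 4 + 33696%:R * s ^+ 4
            - 111 * r ^+ 5 * s ^+ 2 - 1035 * r ^+ 4 * s ^+ 2
            + 4968 * r ^+ 3 * s ^+ 2 + 81000%:R * r ^+ 2 * s ^+ 2
            + 244944%:R * r * s ^+ 2 + 104976%:R * s ^+ 2 + 162 * r ^+ 6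
            - 11664%:R * r ^+ 4 + 209952%:R * r ^+ 2))%:MP]].
Proof.
(* Used instead of congr, which would compute the numerals in unary. *)
have eqC (c d : algC) : c = d -> c%:MP = d%:MP :> {mpoly algC[3]} by move->.
split; last split.
- exact: I3_X16.
(* With [X = r s^2 + 6 s^2 + 3 r^2 + 36] the subtracted term is [8 (2 X / 144)^2 = X^2 / 648], the
   source of the denominator. *)
- rewrite /dixmier_I6 diffop_psi_hessian I3_X16.
  rewrite -!mul_mpolyC -mpolyCM -rmorphXn -mpolyCM -mpolyCB; apply: eqC.
  by field.
(* Each of rho and tau carries a factor 1/9; before cancellation the last four invariants thus have
   denominators 9^2, 9^3, 9^3 and 9^4. *)
- rewrite /dixmier_I9 rho_X16 tau_X16 !quadZ J11_quad /rho_x /rho_z /tau_x /tau_z.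
  by apply: eqC; field.
- rewrite /dixmier_I12 /J03 rho_X16 !quadZ det_hessian_quad /rho_x /rho_z.
  by apply: eqC; field.
- rewrite /dixmier_I15 /J30 tau_X16 !quadZ det_hessian_quad /tau_x /tau_z.
  by apply: eqC; field.
- rewrite /dixmier_I18 rho_X16 tau_X16 !quadZ J22_quad /rho_x /rho_z /tau_x /tau_z.
  by apply: eqC; field.
Qed.
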